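(* Let $\mathcal{H}_A,\mathcal{H}_B,\mathcal{H}_C$ be finite-dimensional Hilbert spaces. For any strictly positive definite density matrix $\rho_{AB}$ on $\mathcal{H}_A\otimes\mathcal{H}_B$, any strictly positive definite density matrix $\sigma_{BC}$ on $\mathcal{H}_B\otimes\mathcal{H}_C$, and any $\alpha\in[0,1]$, $$\rho_A^{-\alpha}\otimes \sigma_{BC}^{\alpha} \;\leq\; \rho_{AB}^{-\alpha}\otimes \sigma_C^{\alpha}$$ as operators on $\mathcal{H}_A\otimes\mathcal{H}_B\otimes\mathcal{H}_C$.
   Context: A density matrix is a positive semidefinite operator of trace one. Marginals are partial traces: $\rho_A=\mathrm{Tr}_B\,\rho_{AB}$, $\sigma_C=\mathrm{Tr}_B\,\sigma_{BC}$. The tensor factors are ordered as $\mathcal{H}_A\otimes\mathcal{H}_B\otimes\mathcal{H}_C$. Powers of positive definite operators are defined by functional calculus. For Hermitian operators, $X\leq Y$ means $Y-X$ is positive semidefinite. *)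

(* Defs.v *)
From mathcomp Require Import all_boot all_order all_algebra.
From mathcomp Require Import complex mxtens.
From mathcomp Require Import reals exp.

Set Implicit Arguments.
Unset Strict Implicit.
Unset Printing Implicit Defensive.

Import Order.TTheory GRing.Theory Num.Theory.
Local Open Scope ring_scope.
Local Open Scope sesquilinear_scope.

Section QDefs.
Variable R : realType.
Local Notation C := R[i].

Definition adjmx m n (A : 'M[C]_(m, n)) : 'M[C]_(n, m) := A ^t*.

Definition qform n (A : 'M[C]_n) (v : 'cV[C]_n) : C := (adjmx v *m A *m v) 0 0.

Definition hermitian_mx n (A : 'M[C]_n) : Prop := adjmx A = A.

Definition psd n (A : 'M[C]_n) : Prop :=
  hermitian_mx A /\ forall v : 'cV[C]_n, 0 <= qform A v.

Definition pd n (A : 'M[C]_n) : Prop :=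
  hermitian_mx A /\ forall v : 'cV[C]_n, v != 0 -> 0 < qform A v.

Definition density n (A : 'M[C]_n) : Prop := psd A /\ \tr A = 1.

Definition loewner_le n (X Y : 'M[C]_n) : Prop := psd (Y - X).

(* Real power via functional calculus: A = P^-1 diag(d) P with P unitary
   (spectral decomposition of the normal matrix A); A^t := P^-1 diag(d^t) P.
   For positive definite A the eigenvalues d are real and > 0. *)
Definition mpow n (A : 'M[C]_n) (t : R) : 'M[C]_n :=
  invmx (spectralmx A)
  *m diag_mx (\row_i (real_complex R (powR (complex.Re (spectral_diag A 0 i)) t)))
  *m spectralmx A.

Definition ptrace2 m n (A : 'M[C]_(m * n)) : 'M[C]_m :=
  \matrix_(i, i') \sum_(j < n) A (mxtens_index (i, j)) (mxtens_index (i', j)).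
Definition ptrace1 m n (A : 'M[C]_(m * n)) : 'M[C]_n :=
  \matrix_(j, j') \sum_(i < m) A (mxtens_index (i, j)) (mxtens_index (i, j')).

End QDefs.

(* Main.v *)
(* The two sides are G(alpha) and H(alpha) for the one-parameter groups of
   positive operators generated by G = rho_A^-1 (x) sigma_BC and
   H = rho_AB^-1 (x) sigma_C, so the Loewner-Heinz theorem reduces the claim to
   alpha = 1.  There, with <j| ranging over a basis of B,
     H - G = \sum_j (Y_j - Z_j) (Y_j - Z_j)^*,
     Y_j = rho_AB^(-1/2) (x) <j| sigma_BC^(1/2),
     Z_j = rho_A^-1 <j| rho_AB^(1/2) (x) sigma_BC^(1/2).
   Loewner-Heinz holds because {t | G(t) <= H(t)} is closed and midpoint-convex:
   an eigenvalue of H(-(x+y)/2) G(x+y) H(-(x+y)/2) is also one of the product of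
   the contractions H(-x) G(x) and G(y) H(-y), hence is at most 1. *)

Require Import Defs.
From mathcomp Require Import all_boot all_order all_algebra.
From mathcomp Require Import complex mxtens.
From mathcomp Require Import reals exp.
From mathcomp Require Import functions interval_inference topology normedtype.
From mathcomp Require Import sequences lra.
Local Open Scope ring_scope.

Set Implicit Arguments.
Unset Strict Implicit.
Unset Printing Implicit Defensive.

Import Order.TTheory GRing.Theory Num.Theory.
Import numFieldNormedType.Exports.

(** * Positive matrices, contractions and real powers *)

Section Psd.
Variable R : realType.
Local Notation C := R[i].

Lemma adjmxE m n (A : 'M[C]_(m, n)) i j : adjmx A i j = Num.conj (A j i).
Proof. by rewrite !mxE. Qed.

Lemma adjmxK m n (A : 'M[C]_(m, n)) : adjmx (adjmx A) = A.
Proof. exact: trmxCK. Qed.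

Lemma adjmxM m n p (A : 'M[C]_(m, n)) (B : 'M[C]_(n, p)) :
  adjmx (A *m B) = adjmx B *m adjmx A.
Proof. by rewrite /adjmx trmx_mul map_mxM. Qed.

Lemma adjmxB m n (A B : 'M[C]_(m, n)) : adjmx (A - B) = adjmx A - adjmx B.
Proof. by apply/matrixP=> i j; rewrite !mxE rmorphB. Qed.

Lemma adjmx_sum m n (I : finType) (F : I -> 'M[C]_(m, n)) :
  adjmx (\sum_k F k) = \sum_k adjmx (F k).
Proof.
apply/matrixP=> i j; rewrite adjmxE !summxE rmorph_sum.
by apply: eq_bigr => k _; rewrite adjmxE.
Qed.

Lemma adjmx1 n : adjmx (1%:M : 'M[C]_n) = 1%:M.
Proof. by rewrite /adjmx trmx1 map_mx1. Qed.

Lemma adjmx_tens m n p q (A : 'M[C]_(m, n)) (B : 'M[C]_(p, q)) :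
  adjmx (A *t B) = adjmx A *t adjmx B.
Proof. by apply/matrixP=> i j; rewrite !mxE rmorphM. Qed.

Lemma adjmx_diag n (d : 'rV[C]_n) : adjmx (diag_mx d) = diag_mx (map_mx Num.conj d).
Proof. by rewrite /adjmx tr_diag_mx map_diag_mx. Qed.

Lemma qformD n (A B : 'M[C]_n) v : qform (A + B) v = qform A v + qform B v.
Proof. by rewrite /qform mulmxDr mulmxDl mxE. Qed.

Lemma qformB n (A B : 'M[C]_n) v : qform (A - B) v = qform A v - qform B v.
Proof. by rewrite /qform mulmxBr mulmxBl !mxE. Qed.

Lemma qform_conj m n (A : 'M[C]_m) (B : 'M[C]_(m, n)) v :
  qform (adjmx B *m A *m B) v = qform A (B *m v).
Proof. by rewrite /qform adjmxM !mulmxA. Qed.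

Lemma qform_eigen n (A : 'M[C]_n) v l :
  A *m v = l *: v -> qform A v = l * qform 1%:M v.
Proof. by move=> Av; rewrite /qform -mulmxA Av -scalemxAr mulmx1 mxE. Qed.

Lemma qform1E n (v : 'cV[C]_n) : qform 1%:M v = \sum_i `|v i 0| ^+ 2.
Proof.
rewrite /qform mulmx1 mxE; apply: eq_bigr => i _.
by rewrite adjmxE mulrC -normCK.
Qed.

Lemma pd1 n : pd (1%:M : 'M[C]_n).
Proof.
split=> [|v v0]; first exact: adjmx1.
rewrite qform1E lt0r sumr_ge0 ?andbT => [|i _]; last exact: exprn_ge0.
apply: contraNneq v0 => /eqP; rewrite psumr_eq0 => [/allP vi|i _]; last exact: exprn_ge0.
apply/eqP/matrixP=> i j; rewrite ord1 mxE; apply/eqP.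
by have := vi i (mem_index_enum _); rewrite expf_eq0 normr_eq0.
Qed.

Lemma pd_psd n (A : 'M[C]_n) : pd A -> psd A.
Proof.
case=> hA pA; split=> // v; have [->|/pA/ltW//] := eqVneq v 0.
by rewrite /qform mulmx0 mxE.
Qed.

Lemma psd_conj m n (A : 'M[C]_m) (B : 'M[C]_(m, n)) :
  psd A -> psd (adjmx B *m A *m B).
Proof.
case=> hA pA; split=> [|v]; last by rewrite qform_conj.
by rewrite /hermitian_mx !adjmxM adjmxK hA mulmxA.
Qed.

Lemma psd_gram m n (B : 'M[C]_(m, n)) : psd (adjmx B *m B).
Proof. by have := psd_conj B (pd_psd (@pd1 m)); rewrite mulmx1. Qed.

Lemma psdD n (A B : 'M[C]_n) : psd A -> psd B -> psd (A + B).
Proof.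
case=> hA pA [hB pB]; split=> [|v]; last by rewrite qformD addr_ge0.
by rewrite /hermitian_mx /adjmx linearD map_mxD; congr (_ + _).
Qed.

Lemma psd0 n : psd (0 : 'M[C]_n).
Proof.
split=> [|v]; first by rewrite /hermitian_mx /adjmx trmx0 map_mx0.
by rewrite /qform mulmx0 mul0mx mxE.
Qed.

Lemma psd_sum n (I : finType) (F : I -> 'M[C]_n) :
  (forall i, psd (F i)) -> psd (\sum_i F i).
Proof.
by move=> pF; elim/big_rec: _ => [|i A _]; [apply: psd0 | apply: psdD].
Qed.

(** [adjmx B] is injective, having [B] as a left inverse, so it keeps nonzero vectors nonzero. This
    serves the compressions that make up a partial trace. *)
Lemma pd_conj_isometry m n (A : 'M[C]_m) (B : 'M[C]_(n, m)) :
  pd A -> B *m adjmx B = 1%:M -> pd (B *m A *m adjmx B).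
Proof.
move=> [hA pA] BB; split=> [|v v0].
  by rewrite /hermitian_mx !adjmxM adjmxK hA mulmxA.
rewrite -[B in B *m A]adjmxK qform_conj; apply: pA.
apply: contraNneq v0 => /(congr1 (mulmx B)).
by rewrite mulmxA BB mul1mx mulmx0 => ->.
Qed.

Lemma pdD n (A B : 'M[C]_n) : pd A -> psd B -> pd (A + B).
Proof.
move=> [hA pA] [hB pB]; split=> [|v v0]; last by rewrite qformD ltr_wpDr ?pA.
by rewrite /hermitian_mx /adjmx linearD map_mxD; congr (_ + _).
Qed.

Lemma pd_sum n (I : finType) (F : I -> 'M[C]_n) (i0 : I) :
  (forall i, pd (F i)) -> pd (\sum_i F i).
Proof.
move=> pF; rewrite (bigD1 i0) //=; apply: pdD => //.
by elim/big_rec: _ => [|i A _]; [apply: psd0 | apply: psdD; apply: pd_psd].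
Qed.

(** Writing [A'] for the adjoint, [B = 1 - A'A] satisfies [B = B'B + A'(1 - AA')A], a sum of two
    positive terms. *)
Lemma contraction_adj m n (A : 'M[C]_(m, n)) :
  psd (1%:M - A *m adjmx A) -> psd (1%:M - adjmx A *m A).
Proof.
move=> pA; set B := 1%:M - adjmx A *m A.
have hB : adjmx B = B by rewrite adjmxB adjmx1 adjmxM adjmxK.
have -> : B = adjmx B *m B + adjmx A *m (1%:M - A *m adjmx A) *m A.
  rewrite hB [X in X *m A]mulmxBr mulmx1 [X in _ + X]mulmxBl !mulmxA.
  rewrite -(mulmxA (adjmx A *m A)) -[X in _ + (X - _)]mul1mx -mulmxBl.
  by rewrite -/B -mulmxDr subrK mulmx1.
by apply: psdD; [apply: psd_gram | apply: psd_conj].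
Qed.

Lemma contraction_qform m n (A : 'M[C]_(m, n)) v :
  psd (1%:M - adjmx A *m A) -> qform 1%:M (A *m v) <= qform 1%:M v.
Proof.
by case=> _ /(_ v); rewrite qformB subr_ge0 -(qform_conj 1%:M) mulmx1.
Qed.

Lemma hermitian_normal n (A : 'M[C]_n) : hermitian_mx A -> A \is normalmx.
Proof. by move=> hA; apply/normalmxP; rewrite -/(adjmx A) hA. Qed.

Lemma adj_spectralK n (A : 'M[C]_n) : spectralmx A *m adjmx (spectralmx A) = 1%:M.
Proof. exact/unitarymxP/spectral_unitarymx. Qed.

Lemma spectral_adjK n (A : 'M[C]_n) : adjmx (spectralmx A) *m spectralmx A = 1%:M.
Proof. exact/mulmx1C/adj_spectralK. Qed.

Lemma invmx_spectral n (A : 'M[C]_n) : invmx (spectralmx A) = adjmx (spectralmx A).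
Proof. exact/invmx_unitary/spectral_unitarymx. Qed.

Lemma hermitian_spectral n (A : 'M[C]_n) : hermitian_mx A ->
  A = adjmx (spectralmx A) *m diag_mx (spectral_diag A) *m spectralmx A.
Proof.
by move=> /hermitian_normal/orthomx_spectralP{1}->; rewrite invmx_spectral.
Qed.

Lemma spectral_eigenvector n (A : 'M[C]_n) i : hermitian_mx A ->
  exists2 v : 'cV[C]_n, v != 0 & A *m v = spectral_diag A 0 i *: v.
Proof.
move=> hA; exists (adjmx (spectralmx A) *m delta_mx i 0).
  apply/eqP => /(congr1 (mulmx (spectralmx A))).
  rewrite mulmxA adj_spectralK mul1mx mulmx0 => /matrixP/(_ i 0).
  by rewrite !mxE !eqxx => /eqP; rewrite oner_eq0.
rewrite {1}(hermitian_spectral hA) -!mulmxA (mulmxA (spectralmx A)).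
rewrite adj_spectralK mul1mx scalemxAr; congr (_ *m _).
apply/matrixP=> k j; rewrite mul_diag_mx !mxE.
by case: (k =P i) => [->|]; rewrite ?mulr0.
Qed.

(** Nonnegative eigenvalues have square roots, so the diagonal factor of the spectral decomposition
    is a Gram matrix. *)
Lemma psd_eigen n (A : 'M[C]_n) : hermitian_mx A ->
  (forall l (v : 'cV[C]_n), v != 0 -> A *m v = l *: v -> 0 <= l) -> psd A.
Proof.
move=> hA eA; rewrite (hermitian_spectral hA); apply: psd_conj.
pose r := map_mx sqrtC (spectral_diag A).
have d0 i : 0 <= spectral_diag A 0 i.
  by have [v v0 /(eA _ _ v0)] := spectral_eigenvector i hA.
have -> : diag_mx (spectral_diag A) = adjmx (diag_mx r) *m diag_mx r.
  rewrite adjmx_diag mulmx_diag; congr diag_mx; apply/matrixP=> i j.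
  rewrite ord1 !mxE geC0_conj ?sqrtC_ge0 //; by rewrite -expr2 sqrtCK.
exact: psd_gram.
Qed.

Lemma pd_spectral_gt0 n (A : 'M[C]_n) i : pd A -> 0 < spectral_diag A 0 i.
Proof.
case=> hA pA; have [v v0 Av] := spectral_eigenvector i hA.
have := pA v v0; rewrite (qform_eigen Av) pmulr_lgt0 //.
by case: (pd1 n) => _; apply.
Qed.

Lemma mpowE n (A : 'M[C]_n) t : mpow A t = adjmx (spectralmx A) *m
  diag_mx (\row_i (real_complex R (powR (complex.Re (spectral_diag A 0 i)) t)))
  *m spectralmx A.
Proof. by rewrite /mpow invmx_spectral. Qed.

Lemma mpow_herm n (A : 'M[C]_n) t : hermitian_mx (mpow A t).
Proof.
rewrite /hermitian_mx mpowE !adjmxM adjmxK mulmxA adjmx_diag.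
congr (_ *m diag_mx _ *m _); apply/matrixP=> i j; rewrite !mxE.
exact: conjc_real.
Qed.

(** [mpow] reads only the real parts of the eigenvalues. The two facts, paired for rewriting, say
    that these parts are positive and lose nothing. *)
Lemma pd_spectral_Re n (A : 'M[C]_n) i : pd A ->
  (0 < complex.Re (spectral_diag A 0 i)) *
  ((complex.Re (spectral_diag A 0 i))%:C%C = spectral_diag A 0 i).
Proof.
move=> /(@pd_spectral_gt0 _ _ i) d0; split; first by move: d0; rewrite ltcE => /andP[].
exact/RRe_real/gtr0_real.
Qed.

Lemma mpowD n (A : 'M[C]_n) s t : pd A -> mpow A s *m mpow A t = mpow A (s + t).
Proof.
move=> pA; rewrite !mpowE -!mulmxA (mulmxA (spectralmx A)) adj_spectralK mul1mx.
congr (_ *m _); rewrite !mulmxA mulmx_diag; congr (diag_mx _ *m _).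
(* At base 0 additivity fails for opposite nonzero exponents, since [powR 0 0 = 1]; positive
   eigenvalues discharge this side condition. *)
apply/matrixP=> i j; rewrite !mxE powRD ?rmorphM //.
by rewrite (gt_eqF (pd_spectral_Re _ pA).1) implybT.
Qed.

Lemma mpow0 n (A : 'M[C]_n) : mpow A 0 = 1%:M.
Proof.
rewrite mpowE -[RHS](spectral_adjK A); congr (_ *m _).
rewrite -[RHS]mulmx1; congr (_ *m _); rewrite -diag_const_mx; congr diag_mx.
by apply/matrixP=> i j; rewrite !mxE powRr0.
Qed.

Lemma mpow1 n (A : 'M[C]_n) : pd A -> mpow A 1 = A.
Proof.
move=> pA; rewrite mpowE [RHS]hermitian_spectral; last by case: pA.
congr (_ *m diag_mx _ *m _); apply/matrixP=> i j; rewrite !mxE ord1.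
by rewrite powRr1 ?(pd_spectral_Re _ pA).2 ?ltW ?(pd_spectral_Re _ pA).1.
Qed.
End Psd.

(** * Midpoint convexity and the Loewner-Heinz inequality *)

Section LoewnerHeinz.
Variable R : realType.
Local Notation C := R[i].

Lemma qform_real n (A : 'M[C]_n) v : hermitian_mx A -> qform A v \is Num.real.
Proof.
move=> hA; apply/CrealP; rewrite -adjmxE.
by rewrite /qform !adjmxM adjmxK hA mulmxA.
Qed.

Lemma qform1Z n (v : 'cV[C]_n) l : qform 1%:M (l *: v) = `|l| ^+ 2 * qform 1%:M v.
Proof.
rewrite !qform1E big_distrr; apply: eq_bigr => i _.
by rewrite mxE normrM exprMn.
Qed.

(** Abstracts the family of real powers of a positive operator; positivity is implicit, since [G t]
    is the square of the hermitian [G (t / 2)]. Tensor products, sign reversal and casts preserve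
    this notion, so the functional calculus of a tensor product is never computed. *)
Definition hermitian_group n (G : R -> 'M[C]_n) :=
  [/\ forall t, hermitian_mx (G t), G 0 = 1%:M & forall s t, G s *m G t = G (s + t)].

Section Midpoint.
Variables (n : nat) (G H : R -> 'M[C]_n).
Hypotheses (gG : hermitian_group G) (gH : hermitian_group H).

(** Conjugation by [H (- x)] turns [H (x + x)] into the identity and [G (x + x) = G x *m G x] into
    [H (- x) *m G x] times its adjoint. *)
Lemma loewner_le_contraction x : loewner_le (G (x + x)) (H (x + x)) ->
  psd (1%:M - H (- x) *m G x *m adjmx (H (- x) *m G x)).
Proof.
case: gG gH => [hG G0 GD] [hH H0 HD] /(psd_conj (H (- x))).
rewrite hH mulmxBr mulmxBl !HD addKr subrr H0 -GD.
by rewrite adjmxM hG hH !mulmxA.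
Qed.

Lemma loewner_le_midpoint x y :
  loewner_le (G (x + x)) (H (x + x)) -> loewner_le (G (y + y)) (H (y + y)) ->
  loewner_le (G (x + y)) (H (x + y)).
Proof.
move=> /loewner_le_contraction c1 /loewner_le_contraction c2.
have [[hG G0 GD] [hH H0 HD]] := (gG, gH).
set C1 := H (- x) *m G x in c1; have k1 := contraction_adj c1.
(* The adjoint makes [C2] equal to [G y *m H (- y)], for which [c2] already has the right order of
   factors. *)
pose C2 := adjmx (H (- y) *m G y).
have k2 : psd (1%:M - adjmx C2 *m C2).
  rewrite adjmxK; exact: c2.
pose z := (x + y) / 2; have zz : z + z = x + y by rewrite /z; lra.
(* Conjugating by [H z] reduces the goal to positivity of [1%:M - X], that is, to eigenvalues of [X]
   at most 1. *)
pose X := H (- z) *m G (x + y) *m H (- z).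
have X_gram : X = adjmx (G z *m H (- z)) *m (G z *m H (- z)).
  by rewrite adjmxM hG hH /X -zz -GD !mulmxA.
have hX : hermitian_mx (1%:M - X).
  by rewrite /hermitian_mx adjmxB adjmx1 X_gram adjmxM adjmxK.
rewrite /loewner_le; have -> : H (x + y) - G (x + y) = adjmx (H z) *m (1%:M - X) *m H z.
  rewrite hH mulmxBr mulmxBl mulmx1 HD zz /X !mulmxA HD subrr H0 mul1mx.
  by rewrite -mulmxA HD addNr H0 mulmx1.
apply/psd_conj/psd_eigen => // m w w0.
have [_ /(_ w w0) w_gt0] := @pd1 R n.
pose l := 1 - m; rewrite mulmxBl mul1mx => Xw.
have {}Xw : X *m w = l *: w.
  by rewrite /l scalerBl scale1r -Xw opprB addrC subrK.
have l0 : 0 <= l.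
  rewrite -(pmulr_lge0 _ w_gt0) -(qform_eigen Xw) X_gram.
  by have [_] := psd_gram (G z *m H (- z)); apply.
have -> : m = 1 - l by rewrite /l opprB addrC subrK.
rewrite subr_ge0.
(* Since [z + z = x + y], the product [C1 *m C2] equals [H (y - z) *m X *m H (z - y)]. By this
   similarity [v] is an eigenvector of the product with the same eigenvalue [l]. *)
pose v := H (y - z) *m w.
have v0 : v != 0.
  apply: contraNneq w0 => /(congr1 (mulmx (H (z - y)))).
  by rewrite mulmx0 mulmxA HD subrKA subrr H0 mul1mx => ->.
have [_ /(_ v v0) v_gt0] := @pd1 R n.
have Cv : C1 *m (C2 *m v) = l *: v.
  rewrite /v scalemxAr -Xw /C2 adjmxM hG hH /C1 /X !mulmxA.
  rewrite -(mulmxA (H (- x))) GD -!mulmxA !(mulmxA (H _) (H _)) !HD.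
  by congr (H _ *m (_ *m (H _ *m _))); rewrite /z; lra.
(* As [l] is nonnegative, it suffices to bound its square, by comparing the squared norms of
   [C1 *m (C2 *m v)] and [v]. *)
rewrite -[_ <= _](ler_sqr (x := l)) ?nnegrE // expr1n -(ger0_norm l0).
rewrite -(ler_pM2r v_gt0) mul1r -qform1Z -Cv.
exact: le_trans (contraction_qform _ k1) (contraction_qform _ k2).
Qed.
End Midpoint.

Lemma loewner_heinz n (G H : R -> 'M[C]_n) alpha :
  hermitian_group G -> hermitian_group H ->
  (forall v, continuous (fun t : R => complex.Re (qform (H t - G t) v))) ->
  loewner_le (G 1) (H 1) -> 0 <= alpha <= 1 -> loewner_le (G alpha) (H alpha).
Proof.
move=> gG gH cont le1 /andP[alpha0 alpha1].
(* Bisection from [[0, 1]], keeping [alpha] inside and the inequality true at both ends. *)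
have bisect k : exists s t : R, [/\ s <= alpha <= t, t - s = 2^-1 ^+ k,
    loewner_le (G s) (H s) & loewner_le (G t) (H t)].
  elim: k => [|k [s [t [/andP[sa at_] st ls lt]]]].
    exists 0, 1; rewrite alpha0 alpha1 subr0 expr0; split; [by []|by []| |exact: le1].
    case: gG gH => [_ -> _] [_ -> _]; rewrite /loewner_le subrr; exact: psd0.
  (* Written as a sum of halves, so that the midpoint lemma applies with [x = s / 2] and
     [y = t / 2]. *)
  pose m := s / 2 + t / 2.
  have lm : loewner_le (G m) (H m).
    by apply: (loewner_le_midpoint gG gH); rewrite -splitr; [exact: ls|exact: lt].
  have [am|ma] := leP alpha m.
    exists s, m; rewrite sa am; split=> //.
    by rewrite exprS -st /m; lra.
  exists m, t; rewrite (ltW ma) at_; split=> //.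
  by rewrite exprS -st /m; lra.
have hA : hermitian_mx (H alpha - G alpha).
  case: gG gH => [hG _ _] [hH _ _].
  by rewrite /hermitian_mx adjmxB hG hH.
split=> // v; rewrite lecE; apply/andP; split.
  have /RIm_real/= := qform_real v hA.
  by move=> /complexI ->.
(* A negative value at [alpha] would persist on a ball around it, but a bisection interval shorter
   than the radius has its left end [s] in that ball. *)
rewrite leNgt; apply/negP => /= f_lt0.
have /cvgr_lt/(_ _ f_lt0) := cont v alpha.
case/nbhs_ballP => e /= e0 fe.
have [k ke] : exists k, 2^-1 ^+ k < e.
  have [k _ /(_ k (leqnn k)) ke] := near_infty_natSinv_expn_lt (PosNum e0).
  by exists k; move: ke => /=; rewrite exprVn div1r.
have [s [t [/andP[sa at_] st [_ /(_ v)] ls _]]] := bisect k.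
have : ball alpha e s.
  rewrite /ball /= ger0_norm ?subr_ge0 //.
  by apply: le_lt_trans ke; rewrite -st lerB.
move=> /fe /=; rewrite ltNge; apply/negP; rewrite negbK.
by move: ls; rewrite lecE => /andP[].
Qed.

End LoewnerHeinz.

(** * Continuity in the exponent *)

Section Continuity.
Variable R : realType.
Local Notation C := R[i].

(** Splitting into real and imaginary parts lets only the topology of [R] enter. *)
Definition ccontinuous (f : R -> C) :=
  continuous (fun t : R => complex.Re (f t)) /\ continuous (fun t : R => complex.Im (f t)).

Definition mxcontinuous m n (F : R -> 'M[C]_(m, n)) := forall i j, ccontinuous (fun t => F t i j).

Lemma ccontinuous_cst (x : C) : ccontinuous (fun=> x).
Proof. by split=> t; exact: cvg_cst. Qed.

Lemma ccontinuous_ext (f g : R -> C) : f =1 g -> ccontinuous f -> ccontinuous g.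
Proof. by move=> /boolp.funext ->. Qed.

Lemma ccontinuousD (f g : R -> C) :
  ccontinuous f -> ccontinuous g -> ccontinuous (fun t => f t + g t).
Proof.
move=> [fR fI] [gR gI]; split=> t.
  have -> : (fun t : R => complex.Re (f t + g t)) =
    ((fun t : R => complex.Re (f t)) + (fun t : R => complex.Re (g t))).
    by apply/boolp.funext => u; rewrite raddfD.
  by apply: continuousD; [exact: fR|exact: gR].
have -> : (fun t : R => complex.Im (f t + g t)) =
    ((fun t : R => complex.Im (f t)) + (fun t : R => complex.Im (g t))).
  by apply/boolp.funext => u; rewrite raddfD.
by apply: continuousD; [exact: fI|exact: gI].
Qed.

Lemma ccontinuousM (f g : R -> C) :
  ccontinuous f -> ccontinuous g -> ccontinuous (fun t => f t * g t).
Proof.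
move=> [fR fI] [gR gI]; split=> t.
  have -> : (fun t : R => complex.Re (f t * g t)) =
    ((fun t : R => complex.Re (f t)) * (fun t : R => complex.Re (g t))) -
    ((fun t : R => complex.Im (f t)) * (fun t : R => complex.Im (g t))).
    by apply/boolp.funext => u; rewrite !fctE; case: (f u) (g u) => [x y] [z w].
  apply: continuousB; apply: continuousM.
  - exact: fR.
  - exact: gR.
  - exact: fI.
  - exact: gI.
have -> : (fun t : R => complex.Im (f t * g t)) =
    ((fun t : R => complex.Re (f t)) * (fun t : R => complex.Im (g t))) +
    ((fun t : R => complex.Im (f t)) * (fun t : R => complex.Re (g t))).
  by apply/boolp.funext => u; rewrite !fctE; case: (f u) (g u) => [x y] [z w].
apply: continuousD; apply: continuousM.
- exact: fR.
- exact: gI.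
- exact: fI.
- exact: gR.
Qed.

Lemma mxcontinuous_cst m n (A : 'M[C]_(m, n)) : mxcontinuous (fun=> A).
Proof. by move=> i j; exact: ccontinuous_cst. Qed.

Lemma mxcontinuousB m n (F G : R -> 'M[C]_(m, n)) :
  mxcontinuous F -> mxcontinuous G -> mxcontinuous (fun t => F t - G t).
Proof.
move=> cF cG i j.
apply: (@ccontinuous_ext (fun t => F t i j + -1 * G t i j)) => [t|].
  by rewrite mulN1r !mxE.
by apply: ccontinuousD => //; apply: ccontinuousM => //; exact: ccontinuous_cst.
Qed.

Lemma ccontinuous_sum (I : Type) (r : seq I) (f : I -> R -> C) :
  (forall k, ccontinuous (f k)) -> ccontinuous (fun t => \sum_(k <- r) f k t).
Proof.
move=> cf; elim: r => [|k r IH].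
  by apply: ccontinuous_ext (ccontinuous_cst 0) => t; rewrite big_nil.
by apply: ccontinuous_ext (ccontinuousD (cf k) IH) => t; rewrite big_cons.
Qed.

Lemma mxcontinuousM m n p (F : R -> 'M[C]_(m, n)) (G : R -> 'M[C]_(n, p)) :
  mxcontinuous F -> mxcontinuous G -> mxcontinuous (fun t => F t *m G t).
Proof.
move=> cF cG i j.
apply: (@ccontinuous_ext (fun t => \sum_k F t i k * G t k j)) => [t|].
  by rewrite mxE.
by apply: ccontinuous_sum => k; exact: ccontinuousM.
Qed.

Lemma mxcontinuous_tens m n p q (F : R -> 'M[C]_(m, n)) (G : R -> 'M[C]_(p, q)) :
  mxcontinuous F -> mxcontinuous G -> mxcontinuous (fun t => F t *t G t).
Proof.
move=> cF cG i j; apply: ccontinuous_ext (ccontinuousM (cF _ _) (cG _ _)) => t.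
by rewrite mxE.
Qed.

Lemma mxcontinuous_comp m n (F : R -> 'M[C]_(m, n)) (g : R -> R) :
  continuous g -> mxcontinuous F -> mxcontinuous (fun t => F (g t)).
Proof.
move=> cg cF i j; have [cR cI] := cF i j.
split=> t.
- by apply: (@continuous_comp _ _ _ g (fun u => complex.Re (F u i j))); [exact: cg|exact: cR].
- by apply: (@continuous_comp _ _ _ g (fun u => complex.Im (F u i j))); [exact: cg|exact: cI].
Qed.

Lemma mxcontinuous_mpow n (A : 'M[C]_n) : pd A -> mxcontinuous (mpow A).
Proof.
move=> pA; apply: mxcontinuousM; last exact: mxcontinuous_cst.
apply: mxcontinuousM; first exact: mxcontinuous_cst.
move=> i j; case: (eqVneq i j) => [<-|ij]; last first.
  apply: ccontinuous_ext (ccontinuous_cst 0) => t.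
  by rewrite !mxE (negbTE ij).
set d := complex.Re (spectral_diag A 0 i).
(* For positive [d] the power is an exponential in [t], away from the special case of [powR] at base
   0. *)
apply: (@ccontinuous_ext (fun t => (expR (t * ln d))%:C%C)) => [t|].
  by rewrite !mxE eqxx /powR gt_eqF // (pd_spectral_Re i pA).1.
split=> t /=; last exact: cvg_cst.
by apply: continuous_comp; [exact: mulrr_continuous|exact: continuous_expR].
Qed.

Lemma qform_continuous n (F : R -> 'M[C]_n) v :
  mxcontinuous F -> continuous (fun t : R => complex.Re (qform (F t) v)).
Proof.
move=> cF; have: mxcontinuous (fun t => adjmx v *m F t *m v).
  apply: mxcontinuousM; last exact: mxcontinuous_cst.
  by apply: mxcontinuousM => //; exact: mxcontinuous_cst.
by move=> /(_ 0 0) [].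
Qed.

End Continuity.

(** * Tensor products, partial traces and reassociation *)

Section Tens.
Variable R : realType.
Local Notation C := R[i].

Lemma tensmx11 m n : 1%:M *t 1%:M = 1%:M :> 'M[C]_(m * n).
Proof.
apply/matrixP=> i j; case: (mxtens_indexP i) => i1 i2; case: (mxtens_indexP j) => j1 j2.
by rewrite tensmxE !mxE (can_eq (@mxtens_indexK m n)) xpair_eqE -natrM mulnb.
Qed.

Lemma tensmx_sumr m n p q (I : finType) (A : 'M[C]_(m, n)) (B : I -> 'M[C]_(p, q)) :
  A *t (\sum_k B k) = \sum_k A *t B k.
Proof.
apply/matrixP=> i j; rewrite mxE !summxE big_distrr.
by apply: eq_bigr => k _; rewrite mxE.
Qed.

Lemma tensmx_suml m n p q (I : finType) (A : I -> 'M[C]_(m, n)) (B : 'M[C]_(p, q)) :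
  (\sum_k A k) *t B = \sum_k A k *t B.
Proof.
apply/matrixP=> i j; rewrite mxE !summxE big_distrl.
by apply: eq_bigr => k _; rewrite mxE.
Qed.

Lemma hermitian_group_mpow n (A : 'M[C]_n) : pd A -> hermitian_group (mpow A).
Proof.
move=> pA; split=> [t||s t]; [exact: mpow_herm|exact: mpow0|exact: mpowD].
Qed.

Lemma hermitian_groupN n (G : R -> 'M[C]_n) :
  hermitian_group G -> hermitian_group (fun t => G (- t)).
Proof.
by case=> hG G0 GD; split=> [t||s t]; rewrite ?oppr0 // GD opprD.
Qed.

Lemma hermitian_group_tens m n (G : R -> 'M[C]_m) (H : R -> 'M[C]_n) :
  hermitian_group G -> hermitian_group H -> hermitian_group (fun t => G t *t H t).
Proof.
move=> [hG G0 GD] [hH H0 HD]; split=> [t||s t].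
- by rewrite /hermitian_mx adjmx_tens hG hH.
- by rewrite G0 H0 tensmx11.
- by rewrite tensmx_mul GD HD.
Qed.

Lemma hermitian_group_cast m n (e : m = n) (G : R -> 'M[C]_m) :
  hermitian_group G -> hermitian_group (fun t => castmx (e, e) (G t)).
Proof. by case: n / e. Qed.

Lemma mxcontinuous_cast m n (e : m = n) (G : R -> 'M[C]_m) :
  mxcontinuous G -> mxcontinuous (fun t => castmx (e, e) (G t)).
Proof. by case: n / e. Qed.

(* <i| (x) 1 and 1 (x) <j| *)
Definition bra1 m n (i : 'I_m) : 'M[C]_(n, m * n) :=
  rowsub (fun j => mxtens_index (i, j)) 1%:M.
Definition bra2 m n (j : 'I_n) : 'M[C]_(m, m * n) :=
  rowsub (fun i => mxtens_index (i, j)) 1%:M.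

(** Both [bra1] and [bra2] are such selection matrices, so compressing by them extracts the blocks
    that partial traces add up. *)
Lemma rowsub_adj k n (f : 'I_k -> 'I_n) (A : 'M[C]_n) :
  rowsub f 1%:M *m A *m adjmx (rowsub f 1%:M) = mxsub f f A.
Proof.
rewrite -rowsubE; apply/matrixP=> i j; rewrite !mxE (bigD1 (f j)) //=.
rewrite !mxE eqxx conjC1 mulr1 big1 ?addr0 // => l lj.
by rewrite !mxE eq_sym (negbTE lj) conjC0 mulr0.
Qed.

Lemma ptrace1E m n (A : 'M[C]_(m * n)) :
  ptrace1 A = \sum_i bra1 n i *m A *m adjmx (bra1 n i).
Proof.
apply/matrixP=> i j; rewrite mxE summxE; apply: eq_bigr => k _.
by rewrite rowsub_adj mxE.
Qed.

Lemma ptrace2E m n (A : 'M[C]_(m * n)) :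
  ptrace2 A = \sum_j bra2 m j *m A *m adjmx (bra2 m j).
Proof.
apply/matrixP=> i j; rewrite mxE summxE; apply: eq_bigr => k _.
by rewrite rowsub_adj mxE.
Qed.

Lemma rowsub1_isometry k n (f : 'I_k -> 'I_n) : injective f ->
  rowsub f 1%:M *m adjmx (rowsub f 1%:M) = 1%:M :> 'M[C]_k.
Proof.
move=> fI; rewrite -[X in X *m _]mulmx1 rowsub_adj.
by apply/matrixP=> i j; rewrite !mxE (inj_eq fI).
Qed.

(** The index [i] shows that the sum of compressions is nonempty; an empty one would be zero. *)
Lemma pd_ptrace1 m n (A : 'M[C]_(m * n)) (i : 'I_m) : pd A -> pd (ptrace1 A).
Proof.
move=> pA; rewrite ptrace1E; apply: (pd_sum i) => k; apply: pd_conj_isometry => //.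
by apply: rowsub1_isometry => x y /(can_inj (@mxtens_indexK m n)) [].
Qed.

Lemma pd_ptrace2 m n (A : 'M[C]_(m * n)) (j : 'I_n) : pd A -> pd (ptrace2 A).
Proof.
move=> pA; rewrite ptrace2E; apply: (pd_sum j) => k; apply: pd_conj_isometry => //.
by apply: rowsub1_isometry => x y /(can_inj (@mxtens_indexK m n)) [].
Qed.

(** The associativity identification as a matrix, so that casting becomes conjugation and fits into
    Gram products. *)
Definition assoc_mx a b c : 'M[C]_(a * b * c, a * (b * c)) :=
  castmx (mulnA a b c, erefl) 1%:M.

Lemma castmx_assoc a b c (A : 'M[C]_(a * (b * c))) :
  castmx (mulnA a b c, mulnA a b c) A = assoc_mx a b c *m A *m adjmx (assoc_mx a b c).
Proof.
rewrite /assoc_mx; move: (mulnA a b c) A; set m := (a * (b * c))%N; move=> e A.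
by case: _ / e; rewrite castmx_id adjmx1 mul1mx mulmx1.
Qed.

(** Resolution of the identity on the shared factor B: summing [|j><j|] over its basis gives 1, up
    to reassociation. *)
Lemma sum_tens_bra a b c n p (M : 'M[C]_(a, n)) (N : 'M[C]_(b * c, p)) :
  \sum_j (adjmx (bra2 a j) *m M) *t (bra1 c j *m N) = assoc_mx a b c *m (M *t N).
Proof.
have -> : assoc_mx a b c *m (M *t N) = castmx (mulnA a b c, erefl) (M *t N).
  rewrite /assoc_mx; move: (mulnA a b c) (M *t N); set m := (a * (b * c))%N; move=> e A.
  by case: _ / e; rewrite mul1mx.
apply/matrixP=> r s; case: (mxtens_indexP r) => r' k; case: (mxtens_indexP r') => i j.
case: (mxtens_indexP s) => x y.
have -> : castmx (mulnA a b c, erefl) (M *t N)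
  (mxtens_index (mxtens_index (i, j), k)) (mxtens_index (x, y)) =
  M i x * N (mxtens_index (j, k)) y.
  (* Both nestings encode the triple by the same number: [(i * b + j) * c + k = i * (b * c) + (j * c
     + k)]. *)
  rewrite castmxE cast_ord_id -tensmxE; congr (_ _ _); apply: val_inj => /=.
  by rewrite mulnDl mulnA addnA.
(* Only the summand whose B index is that of the row survives. *)
rewrite summxE (bigD1 j) //= big1 ?addr0 => [|l lj]; rewrite tensmxE -rowsubE.
  rewrite [X in _ * X]mxE; congr (_ * _); rewrite mxE (bigD1 i) //= big1 ?addr0.
    by rewrite !mxE eqxx conjC1 mul1r.
  move=> l li; rewrite !mxE (can_eq (@mxtens_indexK a b)) xpair_eqE.
  by rewrite (negbTE li) conjC0 mul0r.
rewrite mxE big1 ?mul0r // => h _; rewrite !mxE (can_eq (@mxtens_indexK a b)).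
by rewrite xpair_eqE (negbTE lj) andbF conjC0 mul0r.
Qed.

End Tens.

(** * The inequality at exponent one *)

Section UnitExponent.
Variable R : realType.
Local Notation C := R[i].

(** Completing the square: hermiticity makes the other mixed sum [G] too, so the squares of
    [Y k - W k] add up to [H - G - G + G]. *)
Lemma sum_gram_sub m n (I : finType) (Y W : I -> 'M[C]_(m, n)) (G H : 'M[C]_m) :
  \sum_k Y k *m adjmx (Y k) = H -> \sum_k W k *m adjmx (W k) = G ->
  \sum_k Y k *m adjmx (W k) = G -> hermitian_mx G -> psd (H - G).
Proof.
move=> YY WW YW hG.
have WY : \sum_k W k *m adjmx (Y k) = G.
  rewrite -hG -YW adjmx_sum; apply: eq_bigr => k _.
  by rewrite adjmxM adjmxK.
have -> : H - G = \sum_k (Y k - W k) *m adjmx (Y k - W k).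
  under eq_bigr do rewrite adjmxB mulmxBl !mulmxBr.
  by rewrite !sumrB YY YW WY WW subrr subr0.
apply: psd_sum => k; rewrite -{1}[Y k - W k]adjmxK; exact: psd_gram.
Qed.

Lemma loewner_le_at1 a b c (P : 'M[C]_(a * b)) (Q : 'M[C]_(b * c)) (j0 : 'I_b) :
  pd P -> pd Q ->
  loewner_le
    (castmx (mulnA a b c, mulnA a b c) (mpow (ptrace2 P) (- 1) *t Q))
    (mpow P (- 1) *t ptrace1 Q).
Proof.
move=> pP pQ; have pA := pd_ptrace2 j0 pP.
set r := mpow (ptrace2 P) (- 1).
have hr : adjmx r = r by exact: mpow_herm.
have rA : r *m ptrace2 P = 1%:M.
  by rewrite -[X in _ *m X](mpow1 pA) (mpowD _ _ pA) addNr mpow0.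
have rAr : r *m ptrace2 P *m r = r by rewrite rA mul1mx.
set p := mpow P (1 / 2); have hp : adjmx p = p by exact: mpow_herm.
have pp : p *m p = P by rewrite (mpowD _ _ pP) -splitr (mpow1 pP).
set p' := mpow P (- (1 / 2)); have hp' : adjmx p' = p' by exact: mpow_herm.
have p'p' : p' *m p' = mpow P (- 1)
  by rewrite (mpowD _ _ pP); congr (mpow _ _); lra.
have p'p : p' *m p = 1%:M by rewrite (mpowD _ _ pP) addNr mpow0.
set q := mpow Q (1 / 2); have hq : adjmx q = q by exact: mpow_herm.
have qq : q *m q = Q by rewrite (mpowD _ _ pQ) -splitr (mpow1 pQ).
rewrite /loewner_le castmx_assoc; set J := assoc_mx _ _ _ _.
set s := mpow P (- 1) in p'p' *; clearbody p p' q r s.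
(* Both families act from a space with two copies of B; [Z j] still needs [J] to reach the target
   bracketing. *)
pose Y (j : 'I_b) := p' *t (bra1 R c j *m q).
pose Z (j : 'I_b) := (r *m bra2 R a j *m p) *t q.
apply: (@sum_gram_sub _ _ _ Y (fun j => J *m Z j)).
- rewrite ptrace1E tensmx_sumr; apply: eq_bigr => j _.
  rewrite adjmx_tens tensmx_mul hp' p'p' adjmxM hq !mulmxA.
  by rewrite -(mulmxA _ q q) qq.
(* Inserting [r = r *m ptrace2 P *m r] and expanding the marginal gives the blocks produced by
   [Z j]. *)
- rewrite -{1}rAr ptrace2E mulmx_sumr mulmx_suml tensmx_suml mulmx_sumr mulmx_suml.
  apply: eq_bigr => j _; rewrite adjmxM !mulmxA; congr (_ *m _).
  rewrite -!mulmxA; congr (_ *m _); rewrite adjmx_tens tensmx_mul hq qq.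
  congr (_ *t _); rewrite !adjmxM hr hp !mulmxA.
  by rewrite -(mulmxA _ p p) pp.
(* In the mixed products [p'] cancels [p], leaving the resolution of the identity on B. *)
- rewrite -sum_tens_bra mulmx_suml; apply: eq_bigr => j _.
  rewrite adjmxM mulmxA; congr (_ *m _).
  rewrite adjmx_tens tensmx_mul hq !adjmxM hr hp !mulmxA p'p mul1mx.
  by rewrite -mulmxA qq.
- by rewrite /hermitian_mx !adjmxM adjmxK adjmx_tens hr (proj1 pQ) mulmxA.
Qed.

End UnitExponent.

Theorem theorem2 (R : realType) (a b c : nat)
    (rhoAB : 'M[R[i]]_(a * b)) (sigmaBC : 'M[R[i]]_(b * c)) (alpha : R) :
  density rhoAB -> pd rhoAB ->
  density sigmaBC -> pd sigmaBC ->
  0 <= alpha <= 1 ->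
  loewner_le
    (castmx (mulnA a b c, mulnA a b c)
       (mpow (ptrace2 rhoAB) (- alpha) *t mpow sigmaBC alpha))
    (mpow rhoAB (- alpha) *t mpow (ptrace1 sigmaBC) alpha).
Proof.
move=> [_ trP] pP _ pQ alpha01.
(* Trace one excludes [b = 0], where the matrix would be empty and its trace zero. *)
have j0 : 'I_b.
  case: b rhoAB sigmaBC trP {pP pQ} => [|b'] P Q trP; last exact: ord0.
  exfalso; move: trP; rewrite /mxtrace big1 => [/esym/eqP|]; first by rewrite oner_eq0.
  by case=> k kP; exfalso; rewrite muln0 in kP.
have pA := pd_ptrace2 j0 pP; have pC := pd_ptrace1 j0 pQ.
(* The cast and the negative exponent are absorbed into the groups, so the goal is their comparison
   at [alpha]. *)
pose G t := castmx (mulnA a b c, mulnA a b c)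
  (mpow (ptrace2 rhoAB) (- t) *t mpow sigmaBC t).
pose H t := mpow rhoAB (- t) *t mpow (ptrace1 sigmaBC) t.
have cN n (F : R -> 'M[R[i]]_n) : mxcontinuous F -> mxcontinuous (fun t => F (- t)).
  by apply: mxcontinuous_comp; exact: opp_continuous.
apply: (@loewner_heinz _ _ G H) => //.
- apply/hermitian_group_cast/hermitian_group_tens; last exact: hermitian_group_mpow.
  exact/hermitian_groupN/hermitian_group_mpow.
- apply/hermitian_group_tens; last exact: hermitian_group_mpow.
  exact/hermitian_groupN/hermitian_group_mpow.
- move=> v; apply: qform_continuous; apply: mxcontinuousB.
    by apply: mxcontinuous_tens; [apply: cN|]; exact: mxcontinuous_mpow.
  apply: mxcontinuous_cast.
  by apply: mxcontinuous_tens; [apply: cN|]; exact: mxcontinuous_mpow.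
- by rewrite /G /H !(mpow1 pQ) (mpow1 pC); exact: loewner_le_at1.
Qed.
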